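(* Let $R$ be a simply connected region in the triangular lattice such that the vertex $(0,0)$ lies on $\partial R$, and let $H$ be the set of height functions $h$ of lozenge tilings of $R$ with $h(0,0)=0$ (assume $H\ne\emptyset$). Let $U$ be a set of lattice points of $R$ with $U \supseteq \partial R$, and let $h' : U \to \mathbb{Z}$ satisfy $h' = h$ on $\partial R$ and $h' \equiv h \pmod 3$ on $U$, for some $h \in H$. Then there exists $h_{\mathrm{ext}} \in H$ with $h_{\mathrm{ext}} = h'$ on $U$ if and only if $$h'(y)-h'(x) \le \alpha(x,y)$$ for all pairs $x,y \in U$ such that $x \sim_R y$.
   Context: The triangular lattice tiles the plane by unit equilateral triangles; upward-pointing triangles are black and downward-pointing triangles are white. A region $R$ is a finite simply connected union of such triangles; its points are the lattice vertices in $R$. A lozenge is the union of two adjacent triangles; an edge belongs to a lozenge tiling $T$ if it lies on the boundary of a lozenge of $T$. The height function $h_T$ is an integer function on the vertices of $R$ such that for every edge $(x,y)$ belonging to $T$ having, when traversed from $x$ to $y$, a white triangle on its left, $h_T(x)-h_T(y)=1$ (unique up to an additive constant). All height functions in $H$ agree on $\partial R$ and are congruent modulo $3$ at every point. For lattice vertices $x,y$ of the plane, $\alpha(x,y)$ is the length (number of unit edges) of the shortest lattice path from $x$ to $y$ that at every step has a white triangle on its left. A path $(x_1,\dots,x_n)$ of lattice vertices is geodesic if $\alpha(x_1,x_i)+\alpha(x_i,x_n)=\alpha(x_1,x_n)$ for every $i$. Write $x\sim_R y$ if there is a geodesic path between $x$ and $y$ lying entirely in $R$.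
   Formalization: Heights are normalized by h(y)−h(x)=1 on edges of T with white on the left (opposite sign), and a geodesic must satisfy the additivity of α along every subpath, not only relative to its two ends; with the literal conventions the criterion is not necessary. *)

(* Defs.v *)
From mathcomp Require Import all_boot all_order all_algebra finmap.
From mathcomp Require Import boolp classical_sets.
From mathcomp Require Import zify.

Set Implicit Arguments.
Unset Strict Implicit.
Unset Printing Implicit Defensive.

Import Order.TTheory GRing.Theory Num.Theory.
Local Open Scope ring_scope.
Local Open Scope classical_set_scope.

(* The pair (i, j) stands for the vertex i e1 + j e2 of the triangular lattice,
   with e1 = (1, 0) and e2 = (1/2, sqrt 3 / 2). *)
Definition vertex : Type := (int * int)%type.

(* A unit rhombus with lower left corner v and sides e1, e2 is cut by its short
   diagonal into an upward triangle (v, false) and a downward one (v, true). *)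
Definition triangle : Type := (vertex * bool)%type.

Definition white (t : triangle) : bool := t.2.

Definition corners (t : triangle) : seq vertex :=
  let v := t.1 in
  if white t then [:: v + (1, 0); v + (1, 1); v + (0, 1)]
  else [:: v; v + (1, 0); v + (0, 1)].

Definition is_edge (t : triangle) (x y : vertex) : bool :=
  [&& x != y, x \in corners t & y \in corners t].

(* Since (e1, e2) is positively oriented, z lies strictly to the left of the
   line from x to y iff det (y - x) (z - x) > 0. *)
Definition det (u v : vertex) : int := u.1 * v.2 - u.2 * v.1.

(* The white triangle is one of the lattice: it need not lie in the region. *)
Definition white_left (x y : vertex) : bool :=
  `[< exists t z, [/\ white t, perm_eq [:: x; y; z] (corners t)
                    & 0 < det (y - x) (z - x)] >].

Definition white_left_steps : seq vertex := [:: (0, 1); (-1, 0); (1, -1)].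

Lemma white_leftE (x y : vertex) : white_left x y = (y - x \in white_left_steps).
Proof.
pose offsets : seq vertex := [:: (1, 0); (1, 1); (0, 1)].
have subE (v e f : vertex) : (v + f) - (v + e) = f - e.
  by rewrite opprD addrACA subrr add0r.
have cornersE (v : vertex) : corners (v, true) = map (+%R v) offsets by [].
apply/asboolP/idP.
- case=> -[v b] [z [/= wt]]; move: wt; rewrite /white /= => ->.
  rewrite cornersE => /perm_mem mem3.
  have /mapP[e eo xE] : x \in map (+%R v) offsets by rewrite -mem3 !inE eqxx.
  have /mapP[f fo yE] : y \in map (+%R v) offsets by rewrite -mem3 !inE eqxx !orbT.
  have /mapP[g go zE] : z \in map (+%R v) offsets by rewrite -mem3 !inE eqxx !orbT.
  rewrite {}xE {}yE {}zE !subE {mem3}; move: eo fo go; rewrite !inE.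
  by move=> /or3P[]/eqP-> /or3P[]/eqP-> /or3P[]/eqP->.
- have base (e f g : vertex) : perm_eq [:: e; f; g] offsets ->
      0 < det (f - e) (g - e) -> y - x = f - e ->
      exists t z, [/\ white t, perm_eq [:: x; y; z] (corners t)
                    & 0 < det (y - x) (z - x)].
    move=> pefg dpos yx.
    have [v xE] : exists v, x = v + e by exists (x - e); rewrite subrK.
    have yE : y = v + f by rewrite -[LHS](subrK x) yx xE addrCA subrK.
    exists (v, true), (v + g); split=> //; last by rewrite yx xE subE.
    by rewrite cornersE xE yE (perm_map _ pefg).
  rewrite !inE => /or3P[]/eqP yx.
  + exact: (base (1, 0) (1, 1) (0, 1)).
  + exact: (base (1, 1) (0, 1) (1, 0)).
  + exact: (base (0, 1) (1, 0) (1, 1)).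
Qed.

Definition white_left_path (x y : vertex) (n : nat) : Prop :=
  exists p : seq vertex, [/\ path white_left x p, last x p = y & size p = n].

Lemma white_left_path_trans (x y z : vertex) (m n : nat) :
  white_left_path x y m -> white_left_path y z n -> white_left_path x z (m + n).
Proof.
move=> [p [pp lp sp]] [q [pq lq sq]]; exists (p ++ q).
by rewrite cat_path last_cat size_cat lp pp sp sq.
Qed.

Lemma white_left_path_iter (x d : vertex) (n : nat) :
  d \in white_left_steps ->
  white_left_path x (x + d *+ n) n.
Proof.
move=> hd; elim: n => [|n IHn]; first by exists [::]; rewrite mulr0n addr0.
rewrite -addn1; apply: white_left_path_trans IHn _; exists [:: x + d *+ n.+1].
by split; rewrite ?addn1 //= white_leftE andbT mulrSr addrA (addrC (x + _)) addrK.
Qed.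

Lemma white_left_path_exists (x y : vertex) :
  exists n, `[< white_left_path x y n >].
Proof.
have coords (i j : int) : exists p q k : nat, i = k%:Z - q%:Z /\ j = p%:Z - k%:Z.
  case: i j => m [] n.
  - by exists (m + n)%N, 0%N, m; split; lia.
  - by exists m, n.+1, (m + n.+1)%N; split; lia.
  - by exists n, m.+1, 0%N; split; lia.
  - by exists 0%N, (m.+1 + n.+1)%N, n.+1; split; lia.
have natmulE m (u v : int) : ((u, v) : vertex) *+ m = (u *+ m, v *+ m).
  by elim: m => // m IHm; rewrite !mulrSr IHm.
have [p [q [k [yx1 yx2]]]] := coords (y - x).1 (y - x).2.
have -> : y = x + ((0, 1) *+ p + (-1, 0) *+ q + (1, -1) *+ k).
  rewrite -[LHS](subrK x) addrC; congr (_ + _).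
  rewrite [LHS]surjective_pairing yx1 yx2 !natmulE !mul0rn !mulNrn !natz.
  by congr pair; rewrite /= ?add0r ?addr0 // addrC.
rewrite !addrA; exists (p + q + k)%N; apply/asboolP.
by apply: white_left_path_trans; first apply: white_left_path_trans;
  apply: white_left_path_iter.
Qed.

Definition alpha (x y : vertex) : nat := ex_minn (white_left_path_exists x y).

Definition vertices (R : {fset triangle}) : set vertex :=
  [set x | exists2 t, t \in R & x \in corners t].

Definition boundary (R : {fset triangle}) : set vertex :=
  [set x | vertices R x /\ exists2 t, t \notin R & x \in corners t].

Definition edge_in (R : {fset triangle}) : rel vertex :=
  fun x y => has (fun t => is_edge t x y) R.

(* Edge-path homotopy, fixing both ends, in the simplicial complex of R. *)
Inductive homotopic (R : {fset triangle}) : seq vertex -> seq vertex -> Prop :=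
| Homotopic_refl s : homotopic R s s
| Homotopic_sym s s' : homotopic R s s' -> homotopic R s' s
| Homotopic_trans s s' s'' :
    homotopic R s s' -> homotopic R s' s'' -> homotopic R s s''
| Homotopic_back s s' x y : edge_in R x y ->
    homotopic R (s ++ [:: x; y; x] ++ s') (s ++ [:: x] ++ s')
| Homotopic_triangle s s' x y z t : t \in R -> perm_eq [:: x; y; z] (corners t) ->
    homotopic R (s ++ [:: x; y; z] ++ s') (s ++ [:: x; z] ++ s').

(* The closed union of the triangles of R is connected and has trivial
   fundamental group. *)
Definition simply_connected (R : {fset triangle}) : Prop :=
  (forall x y, vertices R x -> vertices R y ->
     exists2 p, path (edge_in R) x p & last x p = y) /\
  (forall x p, vertices R x -> path (edge_in R) x p -> last x p = x ->
     homotopic R (x :: p) [:: x]).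

Definition lozenge (L : {fset triangle}) : Prop :=
  exists t u x y,
    [/\ t != u, is_edge t x y, is_edge u x y & L = [fset t; u]%fset].

Definition tiling (R : {fset triangle}) (T : {fset {fset triangle}}) : Prop :=
  [/\ forall L, L \in T -> lozenge L,
      forall L t, L \in T -> t \in L -> t \in R
    & forall t, t \in R -> exists! L, L \in T /\ t \in L].

Definition tiling_edge (T : {fset {fset triangle}}) (x y : vertex) : Prop :=
  exists2 L, L \in T & exists! t, t \in L /\ is_edge t x y.

(* Heights increase by 1 along an edge of T with a white triangle on its left:
   this is the sign for which [h y - h x <= alpha x y] holds on every such edge.
   Only the values on [vertices R] matter. *)
Definition height_function (T : {fset {fset triangle}}) (h : vertex -> int) : Prop :=
  forall x y, tiling_edge T x y -> white_left x y -> h y - h x = 1.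

Definition heights (R : {fset triangle}) : set (vertex -> int) :=
  [set h | h (0, 0) = 0 /\ exists2 T, tiling R T & height_function T h].

(* A geodesic is additive along all its subpaths. Requiring additivity only
   relative to the two ends would admit paths longer than [alpha x y] that go
   back and forth inside the parallelogram of vertices lying between x and y. *)
Definition geodesic (x : vertex) (p : seq vertex) : Prop :=
  forall i j k : nat, (i <= j)%N -> (j <= k)%N -> (k <= size p)%N ->
    let v := nth x (x :: p) in
    (alpha (v i) (v j) + alpha (v j) (v k))%N = alpha (v i) (v k).

(* Not symmetric, since alpha is not: the path runs from x to y. *)
Definition geodesic_in (R : {fset triangle}) (x y : vertex) : Prop :=
  vertices R x /\
  exists p, [/\ path (edge_in R) x p, last x p = y & geodesic x p].

(* Main.v *)
(** Heights of tilings are exactly the functions h with h(0,0) = 0 whose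
    increment along each edge of R having a white triangle on its left is 1, or
    -2 if both triangles at the edge belong to R: the edges of increment -2 are
    then those hidden inside the lozenges.  Summing increments along a geodesic
    gives one direction.  Conversely, set h_ext(v) to be the minimum, over the
    x in U and the walks in R from x to v with white triangles on the left, of
    h'(x) + (length of the walk).  It is a height function by the congruence
    modulo 3, and it extends h' as soon as h'(y) - h'(x) <= n for every such
    walk of length n between two points of U.  For this, cut the walk at the
    points of the boundary.  In a piece with interior intermediate vertices,
    either some direction is missing and the piece is geodesic, or a factor
    d e^(k+1) f with d, e, f distinct can be shortened to e^k inside R. *)
Require Import Defs.
From mathcomp Require Import all_boot all_order all_algebra finmap.
From mathcomp Require Import boolp classical_sets zify.
Import Order.TTheory GRing.Theory Num.Theory.
Local Open Scope ring_scope.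
Local Open Scope classical_set_scope.

(** * Triangles and their oriented edges *)

(* The sides (x, y) of t with a white triangle on the left of x -> y *)
Definition edges (t : triangle) : seq (vertex * vertex) :=
  let: ((i, j), b) := t in
  if b then [:: ((i + 1, j), (i + 1, j + 1)); ((i + 1, j + 1), (i, j + 1));
               ((i, j + 1), (i + 1, j))]
  else [:: ((i, j), (i, j + 1)); ((i, j + 1), (i + 1, j));
         ((i + 1, j), (i, j))].

Lemma is_edge_sym t x y : is_edge t x y = is_edge t y x.
Proof. by rewrite /is_edge eq_sym [(x \in _) && _]andbC. Qed.

Lemma addr_vertex (i j k l : int) : ((i, j) : vertex) + (k, l) = (i + k, j + l).
Proof. by []. Qed.

Lemma white_left_coordE (x y : vertex) :
  white_left x y =
  (y \in [:: (x.1, x.2 + 1); (x.1 - 1, x.2); (x.1 + 1, x.2 - 1)]).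
Proof.
case: x => p q; rewrite white_leftE !inE /= !subr_eq.
by rewrite ![_ + (p, q)]addrC !addr_vertex !addr0.
Qed.

Lemma edge_orient t x y :
  is_edge t x y -> ((x, y) \in edges t) || ((y, x) \in edges t).
Proof.
case: t => [[i j] []]; rewrite /is_edge /corners /= !addr_vertex !addr0 !inE.
  by case/and3P=> + /or3P[]/eqP xE /or3P[]/eqP yE; rewrite xE yE !eqxx ?orbT.
by case/and3P=> + /or3P[]/eqP xE /or3P[]/eqP yE; rewrite xE yE !eqxx ?orbT.
Qed.

Lemma edges_is_edge t x y : (x, y) \in edges t -> is_edge t x y.
Proof.
case: t => [[i j] []]; rewrite /is_edge /corners /= !addr_vertex !addr0 !inE.
  by case/or3P=> /eqP[-> ->]; rewrite !xpair_eqE !eqxx ?orbT /=; lia.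
by case/or3P=> /eqP[-> ->]; rewrite !xpair_eqE !eqxx ?orbT /=; lia.
Qed.

Lemma edges_white_left t x y : (x, y) \in edges t -> white_left x y.
Proof.
case: t => [[i j] []]; rewrite white_left_coordE !inE.
  by case/or3P=> /eqP[-> ->] /=; rewrite !xpair_eqE /=; lia.
by case/or3P=> /eqP[-> ->] /=; rewrite !xpair_eqE /=; lia.
Qed.

Lemma white_left_asym x y : white_left x y -> ~~ white_left y x.
Proof.
case: x y => [p q] [r s]; rewrite !white_left_coordE !inE.
by case/or3P=> /eqP[-> ->] /=; rewrite !xpair_eqE /=; lia.
Qed.

Lemma edgesE t x y : ((x, y) \in edges t) = is_edge t x y && white_left x y.
Proof.
apply/idP/andP=> [xy|[/edge_orient/orP[//|yx] xy]].
  by split; [apply: edges_is_edge|apply: edges_white_left xy].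
by have := edges_white_left _ _ _ yx; rewrite (negPf (white_left_asym _ _ xy)).
Qed.

(** A directed edge of this orientation has its white triangle on the left and its black one on the
    right, so the colour tells the two apart. *)
Lemma edges_color_inj t u e :
  e \in edges t -> e \in edges u -> white t = white u -> t = u.
Proof.
case: t u => [[i j] b] [[k l] c] + + /= bc; rewrite /white /= in bc; subst c.
case: b; rewrite !inE => /or3P[]/eqP-> /or3P[]; rewrite !xpair_eqE => ?;
suff [-> ->] : i = k /\ j = l by [].
all: lia.
Qed.

Lemma edge_side x y b :
  white_left x y -> exists2 t, white t = b & (x, y) \in edges t.
Proof.
case: x => p q; rewrite white_left_coordE !inE /= => /or3P[] /eqP->;
case: b; [exists ((p - 1, q), true)|exists ((p, q), false)
  |exists ((p - 1, q - 1), true)|exists ((p - 1, q), false)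
  |exists ((p, q - 1), true)|exists ((p, q - 1), false)] => //;
rewrite /= !inE ?xpair_eqE /=; lia.
Qed.

Lemma edges_neq0 t : exists e, e \in edges t.
Proof. by case: t => [[i j] []]; eexists; exact: mem_head. Qed.

(** Going once around a triangle along these sides makes the increments of any function sum to
    zero. *)
Lemma edges_cycle t x y : (x, y) \in edges t ->
  exists z, [/\ (y, z) \in edges t, (z, x) \in edges t &
    forall e, e \in edges t -> [|| e == (x, y), e == (y, z) | e == (z, x)]].
Proof.
case: t => [[i j] []]; rewrite /= !inE => /or3P[] /eqP[-> ->];
[exists (i, j + 1)|exists (i + 1, j)|exists (i + 1, j + 1)
|exists (i + 1, j)|exists (i, j)|exists (i, j + 1)];
by split=> [||e]; rewrite !inE ?eqxx ?orbT // => /or3P[]/eqP->; rewrite eqxx ?orbT.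
Qed.

Lemma edges_common t u e e' : t != u ->
  e \in edges t -> e \in edges u -> e' \in edges t -> e' \in edges u -> e = e'.
Proof.
case: t u => [[i j] b] [[k l] c] /eqP tu et eu e't e'u.
suff : e == e' by move/eqP.
apply: contra_notT tu => ee'.
suff [-> -> ->] : [/\ i = k, j = l & b = c] by [].
move: et e't ee' eu e'u; case: b; case: c; rewrite !inE;
  by move=> /or3P[] /eqP-> /or3P[] /eqP->; rewrite !xpair_eqE; split; lia.
Qed.

(** * Local characterization of height functions *)

Section Region.

Variable R : {fset triangle}.

Definition white_left_in (x y : vertex) := has (fun t => (x, y) \in edges t) R.

Lemma white_left_inP x y : reflect (exists2 t, t \in R & (x, y) \in edges t) (white_left_in x y).
Proof. exact: hasP. Qed.

Lemma edge_in_white_left_in x y : edge_in R x y = white_left_in x y || white_left_in y x.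
Proof.
apply/hasP/orP => [[t tR /edge_orient/orP[] xy]|[]/white_left_inP[t tR xy]].
- by left; apply/white_left_inP; exists t.
- by right; apply/white_left_inP; exists t.
- by exists t => //; apply: edges_is_edge.
- by exists t => //; rewrite is_edge_sym; apply: edges_is_edge.
Qed.

(* The increment is -2 exactly on the edges hidden inside a lozenge. *)
Definition good (h : vertex -> int) := forall t x y,
  t \in R -> (x, y) \in edges t ->
  h y - h x = 1 \/
  h y - h x = -2 /\ forall u, (x, y) \in edges u -> u \in R.

(** In a lozenge made of [t] and [u], the two sides of [t] not shared with [u] are tiling edges,
    with increment 1. The sum around [t] is zero, so the shared side gets -2. *)
Lemma tiling_good T h : tiling R T -> height_function T h -> good h.
Proof.
move=> [lozT subT exT] hT t x y tR xyt.
have [L [[LT tL] _]] := exT _ tR.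
have [u [ut LE [v [w [vwt vwu]]]]] : exists u, [/\ u != t, L = [fset t; u]%fset &
    exists v w, (v, w) \in edges t /\ (v, w) \in edges u].
  have [t1 [t2 [v [w [t12 e1 e2 LE]]]]] := lozT _ LT.
  have [v' [w' [e1' e2']]] : exists v' w',
      (v', w') \in edges t1 /\ (v', w') \in edges t2.
    rewrite is_edge_sym in e2; move: (e2); rewrite is_edge_sym => e2'.
    case/orP: (edge_orient _ _ _ e1) => vw; [exists v, w|exists w, v];
    by rewrite vw !edgesE ?e2 ?e2' (edges_white_left _ _ _ vw).
  move: tL; rewrite LE !inE => /orP[]/eqP->.
    by exists t2; split; rewrite 1?eq_sym //; exists v', w'.
  by exists t1; split; [|exact: fsetUC|exists v', w'].
have uR : u \in R by apply: (subT L) => //; rewrite LE !inE eqxx orbT.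
have out a b : (a, b) \in edges t -> (a, b) \notin edges u -> h b - h a = 1.
  move=> abt abu; apply: hT (edges_white_left _ _ _ abt).
  exists L => //; exists t; split; first by rewrite edges_is_edge.
  move=> t' [+ abt']; rewrite LE !inE => /orP[]/eqP t'E //.
  by move: abu; rewrite edgesE -t'E abt' (edges_white_left _ _ _ abt).
have [|xyu] := boolP ((x, y) \in edges u); last by left; apply: out.
move=> xyu; right.
have [z [yz zx _]] := edges_cycle _ _ _ xyt.
have tu : t != u by rewrite eq_sym.
have yx : x != y.
  by apply: contraTneq xyt => ->; rewrite edgesE /is_edge eqxx.
split.
  have hyz : h z - h y = 1.
    apply: out => //; apply/negP => /(edges_common _ _ _ _ tu xyt xyu yz) [/eqP].
    by rewrite (negPf yx).
  have hzx : h x - h z = 1.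
    apply: out => //; apply/negP => /(edges_common _ _ _ _ tu xyt xyu zx) [_ /eqP].
    by rewrite eq_sym (negPf yx).
  by clear -hyz hzx; lia.
(* [t] and [u] have opposite colours, so they are the only triangles at the edge. *)
move=> s xys; have [st|/eqP st] := eqVneq (white s) (white t).
  by rewrite (edges_color_inj _ _ _ xys xyt st).
rewrite (edges_color_inj _ _ _ xys xyu) //.
have : white u != white t.
  by apply: contra ut => /eqP /(edges_color_inj _ _ _ xyu xyt) ->.
by clear -st; move: st; do 3 case: white.
Qed.

(** Three increments equal to 1 or -2 with sum zero include exactly one -2. Gluing the triangles
    along these sides matches them in pairs. *)
Lemma good_tiling h : good h -> exists2 T, tiling R T & height_function T h.
Proof.
move=> goodh.
pose flipped (L : {fset triangle}) := exists t u x y, [/\ t != u, (x, y) \in edges t,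
  (x, y) \in edges u, h y - h x = -2 & L = [fset t; u]%fset].
pose T := [fset L in fpowerset R | `[< flipped L >]]%fset.
have TP L : reflect ((L `<=` R)%fset /\ flipped L) (L \in T).
  by rewrite !inE /= fpowersetE; apply: (iffP andP) => -[LR /asboolP].
have down t : t \in R -> exists x y, (x, y) \in edges t /\ h y - h x = -2.
  move=> tR; have [[x y] xy] := edges_neq0 t.
  have [z [yz zx _]] := edges_cycle _ _ _ xy.
  have [h1|[h1 _]] := goodh _ _ _ tR xy; last by exists x, y.
  have [h2|[h2 _]] := goodh _ _ _ tR yz; last by exists y, z.
  have [h3|[h3 _]] := goodh _ _ _ tR zx; last by exists z, x.
  by clear -h1 h2 h3; lia.
have down_uniq t x y x' y' : t \in R -> (x, y) \in edges t -> h y - h x = -2 ->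
    (x', y') \in edges t -> h y' - h x' = -2 -> (x', y') = (x, y).
  move=> tR xy hxy x'y' hx'y'; have [z [yz zx all3]] := edges_cycle _ _ _ xy.
  have := goodh _ _ _ tR yz; have := goodh _ _ _ tR zx.
  by move: (all3 _ x'y') hx'y' hxy => /or3P[]/eqP[-> ->] //; clear; lia.
have inL t L : L \in T -> t \in L -> t \in R.
  by case/TP => /fsubsetP + _; apply.
have flippedP t L : L \in T -> t \in L -> exists u x y, [/\ t != u, (x, y) \in edges t,
  (x, y) \in edges u, h y - h x = -2 & L = [fset t; u]%fset].
  case/TP => _ [t1 [t2 [x [y [t12 e1 e2 hxy ->]]]]].
  rewrite !inE => /orP[]/eqP->; first by exists t2, x, y.
  by exists t1, x, y; rewrite eq_sym fsetUC.
exists T.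
  split=> [L /TP[_ [t [u [x [y [tu xyt xyu _ ->]]]]]]|L t|t tR].
  - by exists t, u, x, y; split=> //; apply: edges_is_edge.
  - exact: inL.
  have [x [y [xyt hxy]]] := down _ tR.
  (* An increment -2 forces both triangles at the edge into [R]; the partner of [t] is the one of
     the other colour. *)
  have [|[_ bothR]] := goodh _ _ _ tR xyt; first by rewrite hxy.
  have [u uc xyu] := edge_side x y (~~ white t) (edges_white_left _ _ _ xyt).
  have tu : t != u by apply: contra_eqN uc => /eqP->; case: white.
  exists [fset t; u]%fset; split.
    split; last by rewrite !inE eqxx.
    apply/TP; split; last by exists t, u, x, y.
    by apply/fsubsetP => s; rewrite !inE => /orP[]/eqP-> //; apply: bothR.
  move=> L [LT tL]; have [u' [x' [y' [tu' e1 e2 hx'y' ->]]]] := flippedP _ _ LT tL.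
  rewrite (down_uniq t x y x' y' tR xyt hxy e1 hx'y') in e2.
  congr [fset t; _]%fset; apply: (edges_color_inj _ _ _ xyu e2); rewrite uc.
  have : white u' != white t.
    apply: contra tu' => /eqP.
    by move/(edges_color_inj _ _ _ e2 xyt) => ->.
  by do 2 case: white.
move=> x y [L LT [t [[tL xyt] uniqt]]] xy.
have xyt' : (x, y) \in edges t by rewrite edgesE xyt.
have tR := inL _ _ LT tL.
have [//|[hxy _]] := goodh _ _ _ tR xyt'.
(* With increment -2, the partner [u] would contain the edge too, against the uniqueness of [t] in
   [L]. *)
have [u [x' [y' [tu e1 e2 hx'y' LE]]]] := flippedP _ _ LT tL.
rewrite (down_uniq t x y x' y' tR xyt' hxy e1 hx'y') in e2.
case/eqP: tu; apply: uniqt; rewrite LE !inE eqxx orbT; split=> //.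
exact: edges_is_edge.
Qed.

Lemma heightsP h : heights R h <-> h (0, 0) = 0 /\ good h.
Proof.
split=> [[h0 [T RT hT]]|[h0 /good_tiling]]; split=> //.
exact: tiling_good RT hT.
Qed.

End Region.

(** * Straight paths *)

(* Minus twice the inner product of d and v in the basis (e1, e2): it is 1 on
   the two other directions and -2 on d, so it bounds lengths from below. *)
Definition away (d v : vertex) : int :=
  - (2 * d.1 * v.1 + 2 * d.2 * v.2 + d.1 * v.2 + d.2 * v.1).

Lemma awayD d u v : away d (u + v) = away d u + away d v.
Proof. by rewrite /away /= !mulrDr; lia. Qed.

Lemma away_step (d e : vertex) : d \in white_left_steps -> e \in white_left_steps ->
  away d e = if e == d then -2 else 1.
Proof. by rewrite !inE => /or3P[]/eqP-> /or3P[]/eqP->. Qed.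

Lemma away_le (d x y : vertex) n :
  d \in white_left_steps -> white_left_path x y n -> away d (y - x) <= n%:Z.
Proof.
move=> dstep [p [xp <- <-]]; elim: p x xp => [|z p IHp] x /=.
  by rewrite subrr /away /= !mulr0.
case/andP=> xz /IHp le_p; rewrite white_leftE in xz.
rewrite -[last z p - x](subrKA z) awayD (away_step _ _ dstep xz).
by move: (away _ _) le_p => a le_p; case: ifP => _; lia.
Qed.

Lemma alphaP x y : white_left_path x y (alpha x y).
Proof. by rewrite /alpha; case: ex_minnP => n /asboolP. Qed.

Lemma alpha_min x y n : white_left_path x y n -> (alpha x y <= n)%N.
Proof. by rewrite /alpha; case: ex_minnP => m _ + /asboolP; apply. Qed.

(** The word itself is a path of this length. Each of its steps raises [away d] by exactly 1, which
    no step can exceed, so no path is shorter. *)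
Lemma alpha_straight (d x : vertex) (ds : seq vertex) :
  d \in white_left_steps -> d \notin ds -> {subset ds <= white_left_steps} ->
  alpha x (x + \sum_(e <- ds) e) = size ds.
Proof.
move=> dstep dds dsteps; apply/eqP; rewrite eqn_leq; apply/andP; split.
  apply: alpha_min; elim: ds x {dds} dsteps => [|e ds IHds] x dsteps.
    by rewrite big_nil addr0; exists [::].
  rewrite big_cons addrA -[size _]/(1 + size ds)%N.
  apply: white_left_path_trans (IHds _ _); last first.
    by move=> f fds; apply: dsteps; rewrite inE fds orbT.
  exists [:: x + e]; split=> //=.
  by rewrite white_leftE addrAC subrr add0r dsteps ?mem_head.
have := away_le _ _ _ _ dstep (alphaP x (x + \sum_(e <- ds) e)).
suff -> : away d (x + \sum_(e <- ds) e - x) = (size ds)%:Z by [].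
rewrite addrAC subrr add0r.
elim: ds dds dsteps => [|e ds IHds] dds dsteps.
  by rewrite big_nil /away /= !mulr0.
move: dds; rewrite inE negb_or eq_sym => /andP[ed dds].
rewrite big_cons awayD (away_step _ _ dstep (dsteps _ (mem_head _ _))) (negPf ed).
rewrite IHds // => f fds; apply: dsteps.
by rewrite inE fds orbT.
Qed.

(** A change of direction turns around a single triangle; this provides the triangles that carry the
    shortened walk. *)
Lemma turn_edges (x d e : vertex) :
  d \in white_left_steps -> e \in white_left_steps -> d != e ->
  exists2 t, (x, x + d) \in edges t & (x + d, x + d + e) \in edges t.
Proof.
case: x => i j; rewrite !inE => /or3P[]/eqP-> /or3P[]/eqP-> // _;
[exists (i - 1, j, true)|exists (i, j, false)|exists (i - 1, j, false)
|exists (i - 1, j - 1, true)|exists (i, j - 1, true)|exists (i, j - 1, false)];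
by rewrite /= !inE !addr_vertex !xpair_eqE; lia.
Qed.

(** * Words in the three directions *)

Lemma nseq_prefix (T : eqType) (e f : T) s : {subset s <= [:: e; f]} ->
  exists k, s = nseq k e \/ exists s', s = nseq k e ++ f :: s'.
Proof.
elim: s => [|g s IHs] sub; first by exists 0%N; left.
have := sub g (mem_head _ _); rewrite !inE => /orP[]/eqP->; last first.
  by exists 0%N; right; exists s.
have [|k] := IHs; first by move=> x xs; apply: sub; rewrite inE xs orbT.
by case=> [->|[s' ->]]; exists k.+1; [left|right; exists s'].
Qed.

Lemma white_left_steps_compl (d : vertex) : d \in white_left_steps ->
  exists e f : vertex, [/\ e \in white_left_steps, f \in white_left_steps,
    d + e + f = 0, [&& e != f, e != d & f != d] &
    forall g : vertex, g \in white_left_steps -> [|| g == d, g == e | g == f]].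
Proof.
rewrite !inE => /or3P[]/eqP->; [exists (-1, 0), (1, -1)
|exists (0, 1), (1, -1)|exists (0, 1), (-1, 0)]; split=> // g;
by rewrite !inE => /or3P[]->; rewrite ?orbT.
Qed.

(** Letters are added in front. When the new letter [d] is the one missing so far, the rest is a
    word in [e] and [f]: either it misses one of them, or its first run, with [d] before it and the
    other letter after it, is the factor. *)
Lemma word_two_or_factor (ds : seq vertex) : {subset ds <= white_left_steps} ->
  (exists2 d : vertex, d \in white_left_steps & d \notin ds) \/
  exists (s1 s2 : seq vertex) (d e f : vertex) k,
    [/\ d + e + f = 0, e != f & ds = s1 ++ d :: nseq k.+1 e ++ f :: s2].
Proof.
elim: ds => [|d ds IHds] dsteps; first by left; exists (0, 1).
have [|[d' d'step d'ds]|] := IHds.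
- by move=> e eds; apply: dsteps; rewrite inE eds orbT.
- have [d'd|] := eqVneq d' d; last first.
    by move=> d'd; left; exists d' => //; rewrite inE negb_or d'd.
  subst d'.
  have [e [f [estep fstep sum0 /and3P[ef ed fd] cover]]] :=
    white_left_steps_compl _ d'step.
  have sub g : g \in ds -> g \in [:: e; f].
    move=> gds; have := cover g; rewrite dsteps ?inE ?gds ?orbT // => /(_ isT).
    by case: eqP => // gd; rewrite -gd gds in d'ds.
  case: ds sub {IHds dsteps d'ds} => [|g ds] sub.
    by left; exists e => //; rewrite !inE.
  have sub' h : h \in ds -> h \in [:: e; f].
    by move=> hds; apply: sub; rewrite inE hds orbT.
  have := sub g (mem_head _ _); rewrite !inE => /orP[]/eqP->.
  + have [k [->|[s ->]]] := nseq_prefix _ _ _ _ sub'.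
      left; exists f => //; rewrite !inE mem_nseq !negb_or fd.
      by rewrite [f == e]eq_sym (negPf ef) andbF.
    by right; exists [::], s, d, e, f, k.
  + have [|k [->|[s ->]]] := nseq_prefix _ f e ds.
    * by move=> h /sub'; rewrite !inE orbC.
    * by left; exists e => //; rewrite !inE mem_nseq !negb_or ed (negPf ef) andbF.
    * by right; exists [::], s, d, f, e, k; rewrite eq_sym addrAC.
- case=> s1 [s2 [a [e [f [k [sum0 ef dsE]]]]]].
  by right; exists (d :: s1), s2, a, e, f, k; rewrite dsE.
Qed.

(** * Walks in a region *)

Section Walks.

Variable R : {fset triangle}.

Local Notation white_left_in := (white_left_in R).
Local Notation edge_in := (edge_in R).

(** Walks are words of steps rather than lists of vertices, so that a factor can be replaced without
    changing what follows. *)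
Fixpoint walk (x : vertex) (ds : seq vertex) :=
  if ds is d :: ds' then white_left_in x (x + d) && walk (x + d) ds' else true.

Lemma walk_cat x (s1 : seq vertex) s2 :
  walk x (s1 ++ s2) = walk x s1 && walk (x + \sum_(d <- s1) d) s2.
Proof.
elim: s1 x => [|d s1 IHs] x /=; first by rewrite big_nil addr0.
by rewrite IHs big_cons addrA andbA.
Qed.

Lemma white_left_in_step (x d : vertex) : white_left_in x (x + d) -> d \in white_left_steps.
Proof.
by case/white_left_inP=> t _ /edges_white_left; rewrite white_leftE addrAC subrr add0r.
Qed.

Lemma walk_steps x ds : walk x ds -> {subset ds <= white_left_steps}.
Proof.
elim: ds x => //= d ds IHds x /andP[/white_left_in_step dstep /IHds dsteps] e.
by rewrite inE => /orP[/eqP->|/dsteps].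
Qed.

Lemma white_left_in_vertices x y : white_left_in x y -> vertices R x /\ vertices R y.
Proof.
by case/white_left_inP=> t tR /edges_is_edge/and3P[_ xt yt]; split; exists t.
Qed.

Lemma white_left_in_back x y : white_left_in x y ->
  exists ds : seq vertex, [/\ walk y ds, size ds = 2%N & y + \sum_(d <- ds) d = x].
Proof.
case/white_left_inP=> t tR /edges_cycle[z [yz zx _]].
have stepE (a b : vertex) : a + (b - a) = b by rewrite addrC subrK.
exists [:: z - y; x - z]; rewrite !big_cons big_nil addr0 addrA /= !stepE.
by split=> //; rewrite andbT; apply/andP; split; apply/white_left_inP; exists t.
Qed.

(** An edge crossed against its orientation is replaced by the two other sides of a triangle of
    [R]. *)
Lemma walk_connected x p : path edge_in x p ->
  exists2 ds : seq vertex, walk x ds & x + \sum_(d <- ds) d = last x p.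
Proof.
elim: p x => [|y p IHp] x /=; first by exists [::]; rewrite // big_nil addr0.
case/andP=> xy /IHp[ds yds yE].
suff [es xes xE] : exists2 es, walk x es & x + \sum_(d <- es) d = y.
  by exists (es ++ ds); [rewrite walk_cat xes xE|rewrite big_cat addrA /= xE].
move: xy; rewrite edge_in_white_left_in => /orP[xy|/white_left_in_back[es [? _ ?]]];
  last by exists es.
by exists [:: y - x]; rewrite /= ?big_seq1 addrC subrK ?xy.
Qed.

Lemma interior_corner x t :
  vertices R x -> ~ boundary R x -> x \in corners t -> t \in R.
Proof.
move=> xR nbx xt; apply: contra_notT nbx => tR; split=> //.
by exists t.
Qed.

(** Every factor of the word misses [d] as well, so [alpha] between two vertices of the walk is the
    difference of their positions. *)
Lemma walk_geodesic (d x : vertex) (ds : seq vertex) :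
  vertices R x -> d \in white_left_steps -> d \notin ds -> walk x ds ->
  geodesic_in R x (x + \sum_(e <- ds) e).
Proof.
move=> xR dstep dds xds; split=> //; exists (scanl +%R x ds).
have dsteps := walk_steps _ _ xds.
have vE i : (i <= size ds)%N ->
    nth x (x :: scanl +%R x ds) i = x + \sum_(e <- take i ds) e.
  move: (x in nth x) => x0; elim: ds x i {dds xds dsteps xR} => [|e ds IHds] x [|i] //=;
    rewrite ?big_nil ?addr0 //.
  by move=> /IHds ->; rewrite big_cons addrA.
split.
- elim: ds x xds {vE dds dsteps xR} => //= e ds IHds x /andP[xe /IHds ->].
  by rewrite edge_in_white_left_in xe.
- by rewrite (last_nth x) size_scanl vE // take_size.
- move=> i j k ij jk; rewrite size_scanl => kds /=.
  have sub a b : (a <= b)%N -> (b <= size ds)%N ->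
      alpha (nth x (x :: scanl +%R x ds) a) (nth x (x :: scanl +%R x ds) b)
      = (b - a)%N.
    move=> ab bds; rewrite !vE ?(leq_trans ab) //.
    have sizeE : size (drop a (take b ds)) = (b - a)%N by rewrite size_drop size_takel.
    rewrite -sizeE -(alpha_straight d (x + \sum_(e <- take a ds) e)) //.
    + rewrite -addrA -big_cat /=; congr (alpha _ (x + bigop _ _ _)).
      by rewrite -{1}(cat_take_drop a (take b ds)) take_takel.
    + by apply: contra dds => /mem_drop/mem_take.
    + by move=> e /mem_drop/mem_take/dsteps.
  have [jds ik] := (leq_trans jk kds, leq_trans ij jk).
  by rewrite (sub i j) // (sub j k) // (sub i k) //; lia.
Qed.

Lemma walk_end_vertices x ds :
  vertices R x -> walk x ds -> vertices R (x + \sum_(d <- ds) d).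
Proof.
elim: ds x => [|d ds IHds] x xR /=; first by rewrite big_nil addr0.
by case/andP=> /white_left_in_vertices[_ xdR] /(IHds _ xdR); rewrite big_cons addrA.
Qed.

Lemma walk_nseq x (d : vertex) k :
  (forall j, (j < k)%N -> white_left_in (x + d *+ j) (x + d *+ j + d)) ->
  walk x (nseq k d).
Proof.
elim: k x => //= k IHk x xd; have := xd 0%N isT; rewrite mulr0n addr0 => -> /=.
by apply: IHk => j jk; have := xd j.+1 jk; rewrite mulrS addrA.
Qed.

Lemma nseq_split (T : Type) (a : T) j k : (j <= k)%N ->
  nseq k.+1 a = nseq j.+1 a ++ nseq (k - j) a.
Proof. by move=> jk; rewrite -nseqD addSn subnKC. Qed.

(* The new walk is the middle stretch of the old one translated by f, and each
   of its edges spans a triangle with an interior vertex of the old one. *)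
Lemma walk_shortcut x (d e f : vertex) k : d + e + f = 0 -> e != f ->
  vertices R x -> walk x (d :: nseq k.+1 e ++ [:: f]) ->
  (forall j, (j <= k)%N -> ~ boundary R (x + d + \sum_(g <- nseq j.+1 e) g)) ->
  walk x (nseq k e).
Proof.
move=> sum0 ef xR xds inner; apply: walk_nseq => j /ltnW jk.
pose z := x + d + e *+ j.+1.
have sumE : \sum_(g <- nseq j.+1 e) g = e *+ j.+1.
  by rewrite big_nseq -Monoid.iteropE.
have zR : vertices R z.
  move: xds; rewrite (nseq_split _ _ _ _ jk) -catA -cat_cons walk_cat.
  case/andP=> /(walk_end_vertices _ _ xR).
  by rewrite big_cons sumE addrA.
have steps := walk_steps _ _ xds.
have [|||t] := turn_edges z f e.
- by apply: steps; rewrite inE mem_cat mem_head !orbT.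
- by apply: steps; rewrite !inE eqxx orbT.
- by rewrite eq_sym.
(* The translate by [f] of the interior vertex [z] is a vertex of the shortcut, because
   [d + e + f = 0]. *)
have -> : z + f = x + e *+ j.
  rewrite /z mulrS !addrA [LHS]addrAC; congr (_ + _).
  by rewrite -!addrA [d + _]addrA sum0 addr0.
move=> /edges_is_edge/and3P[_ zt _] xt; apply/white_left_inP; exists t => //.
by apply: interior_corner zt; rewrite // /z -sumE; apply: inner.
Qed.

(** * The height bound along all walks between points of [U] *)

Section Extension.

Variables (U : set vertex) (h' : vertex -> int).
Hypotheses (UR : U `<=` vertices R) (bU : boundary R `<=` U).
Hypothesis (h'alpha : forall x y, U x -> U y -> geodesic_in R x y ->
  h' y - h' x <= (alpha x y)%:Z).

Lemma walk_height x ds : U x -> U (x + \sum_(d <- ds) d) -> walk x ds ->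
  h' (x + \sum_(d <- ds) d) - h' x <= (size ds)%:Z.
Proof.
have [n] := ubnP (size ds); elim: n x ds => // n IHn x ds ltn Ux Uy xds.
(* A walk through an intermediate point of [U] is cut there, and the bounds of the two shorter
   pieces add up. *)
have [[s1 [s2 [dsE s1n0 s2n0 Uz]]]|noU] := pselect (exists s1 s2 : seq vertex,
    [/\ ds = s1 ++ s2, s1 != [::], s2 != [::] & U (x + \sum_(d <- s1) d)]).
  subst ds; rewrite -!size_eq0 in s1n0 s2n0.
  rewrite walk_cat in xds; case/andP: xds => xs1 zs2.
  rewrite size_cat big_cat /= addrA in ltn Uy *.
  rewrite ltnS in ltn; rewrite -!lt0n in s1n0 s2n0.
  have lt1 : (size s1 < n)%N by apply: leq_trans ltn; rewrite -addn1 leq_add2l.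
  have lt2 : (size s2 < n)%N by apply: leq_trans ltn; rewrite -add1n leq_add2r.
  have := lerD (IHn _ _ lt2 Uz Uy zs2) (IHn _ _ lt1 Ux Uz xs1).
  by rewrite subrKA -PoszD addnC.
have [[d dstep dds]|] := word_two_or_factor _ (walk_steps _ _ xds).
  rewrite -(alpha_straight _ x _ dstep dds) ?(walk_steps _ _ xds) //.
    exact: h'alpha (walk_geodesic _ _ _ (UR _ Ux) dstep dds xds).
  exact: walk_steps xds.
case=> s1 [s2 [d [e [f [k [sum0 ef dsE]]]]]].
have dsE' : ds = s1 ++ (d :: nseq k.+1 e ++ [:: f]) ++ s2.
  by rewrite dsE /= -catA.
(* The replacement keeps the end of the walk and removes three steps, so induction applies and even
   gives a stronger bound. *)
have sum3 : \sum_(g <- d :: nseq k.+1 e ++ [:: f]) g = \sum_(g <- nseq k e) g.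
  rewrite big_cons big_cat big_seq1 /= !big_cons !addrA.
  by rewrite addrAC sum0 add0r.
have := IHn x (s1 ++ nseq k e ++ s2).
rewrite dsE' !big_cat sum3 /= in Uy *.
move: xds; rewrite dsE' 2!walk_cat => /and3P[xs1 zds ys2].
move=> /(_ _ Ux Uy) IH.
apply: le_trans (IH _ _) _.
- by move: ltn; rewrite dsE' !size_cat /= !size_cat !size_nseq /=; lia.
- rewrite !walk_cat xs1 -sum3 ys2 andbT /=.
  apply: walk_shortcut sum0 ef (walk_end_vertices _ _ (UR _ Ux) xs1) zds _.
  (* A boundary vertex on the run would be a point of [U] strictly inside the walk. *)
  move=> j jk bj; apply: noU.
  exists (s1 ++ d :: nseq j.+1 e), (nseq (k - j) e ++ f :: s2).
  split.
  + by rewrite dsE (nseq_split _ _ _ _ jk) -[RHS]catA cat_cons -!catA.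
  + by case: (s1).
  + by case: nseq.
  + by apply: bU; rewrite big_cat big_cons /= !addrA.
- by rewrite !size_cat /= !size_cat !size_nseq /=; lia.
Qed.

End Extension.

End Walks.

Lemma int_set_min (S : set int) (b : int) : S !=set0 ->
  (forall k, S k -> b <= k) -> exists2 m, S m & forall k, S k -> m <= k.
Proof.
move=> [k0 Sk0] lb.
have natE k : S k -> exists n : nat, k = b + n%:Z.
  by move=> /lb bk; exists `|k - b|%N; lia.
have exS : exists n : nat, `[< S (b + n%:Z) >].
  by have [n k0E] := natE _ Sk0; exists n; apply/asboolP; rewrite -k0E.
case: (ex_minnP exS) => m /asboolP Sm minm; exists (b + m%:Z) => // k Sk.
have [n kE] := natE _ Sk; rewrite kE lerD2l lez_nat.
by apply: minm; apply/asboolP; rewrite -kE.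
Qed.

(** * Growth of height functions along edges, geodesics and walks *)

Section Heights.

Variable R : {fset triangle}.

Lemma alpha_white_left_in x y : white_left_in R x y -> (0 < alpha x y)%N /\ (1 < alpha y x)%N.
Proof.
case/white_left_inP=> t _ /edges_white_left; rewrite white_leftE => dstep.
have [e [_ [estep _ _ /and3P[_ ed _] _]]] := white_left_steps_compl _ dstep.
have := away_le _ _ _ _ estep (alphaP x y).
have := away_le _ _ _ _ dstep (alphaP y x).
have -> : away (y - x) (x - y) = 2.
  have : away (y - x) (y - x + (x - y)) = 0.
    by rewrite subrKA subrr /away /= !mulr0.
  by rewrite awayD away_step // eqxx; move: (away _ _) => a; lia.
by rewrite (away_step _ _ estep dstep) eq_sym (negPf ed); lia.
Qed.

Variable h : vertex -> int.
Hypothesis goodh : good R h.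

Lemma good_edge x y : white_left_in R x y -> h y - h x = 1 \/ h y - h x = -2.
Proof. by case/white_left_inP=> t tR /(goodh _ _ _ tR)[|[]]; [left|right]. Qed.

Lemma good_le_alpha x y : edge_in R x y -> h y - h x <= (alpha x y)%:Z.
Proof.
rewrite edge_in_white_left_in => /orP[] xy; have [a1 a2] := alpha_white_left_in _ _ xy;
by case: (good_edge _ _ xy); move: (h x) (h y) a1 a2 => a b; lia.
Qed.

(** The bounds on single edges telescope, since [alpha] is additive along a geodesic and the tail is
    again geodesic. *)
Lemma good_geodesic x y : geodesic_in R x y -> h y - h x <= (alpha x y)%:Z.
Proof.
case=> _ [p [xp <- geo]]; elim: p x xp geo => [|z p IHp] x /=.
  by rewrite subrr.
case/andP=> xz zp geo; have := geo 0%N 1%N (size p).+1 isT isT (leqnn _).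
rewrite /= -last_nth => <-.
rewrite PoszD -[h (last z p) - h x](subrKA (h z)) addrC.
apply: lerD; first exact: good_le_alpha.
apply: IHp zp _ => i j k ij jk kp /=.
have := geo i.+1 j.+1 k.+1 ij jk kp.
have zE l : (l <= size p)%N -> nth x (z :: p) l = nth z (z :: p) l.
  by move=> lp; apply: set_nth_default.
by rewrite /= !zE // ?(leq_trans jk) // (leq_trans ij) // (leq_trans jk).
Qed.

(** Both possible increments, 1 and -2, are 1 modulo 3. *)
Lemma good_walk_mod x ds : walk R x ds ->
  (h (x + \sum_(d <- ds) d)%R = h x + (size ds)%:Z %[mod 3])%Z.
Proof.
elim: ds x => [|d ds IHds] x /=; first by rewrite big_nil !addr0.
case/andP=> /good_edge xd /IHds; rewrite big_cons addrA.
by move: (h _) (h _) (h _) xd => a b c; lia.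
Qed.

End Heights.

(** * Extension by the minimum over walks *)

Theorem theorem4p2 (R : {fset triangle}) (U : set vertex) (h' : vertex -> int) :
  simply_connected R ->
  boundary R (0, 0) ->
  heights R !=set0 ->
  U `<=` vertices R ->
  boundary R `<=` U ->
  (exists h : vertex -> int,
     [/\ heights R h,
         forall x, boundary R x -> h' x = h x
       & forall x, U x -> (h' x = h x %[mod 3])%Z]) ->
  (exists h_ext : vertex -> int,
     heights R h_ext /\ forall x, U x -> h_ext x = h' x)
  <->
  (forall x y, U x -> U y -> geodesic_in R x y ->
     h' y - h' x <= (alpha x y)%:Z).
Proof.
move=> [conn _] b0 _ UR bU [h [/heightsP[h0 goodh] h'b h'mod]]; split.
  move=> [f [/heightsP[_ goodf] fU]] x y Ux Uy xy.
  rewrite -(fU x Ux) -(fU y Uy); exact: good_geodesic goodf _ _ xy.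
move=> h'alpha.
pose S v : set int := [set k | exists x ds,
  [/\ U x, walk R x ds, x + \sum_(d <- ds) d = v & k = h' x + (size ds)%:Z]].
(* Closing a walk counted in [S v] by a walk from [v] back to [U] gives a walk between points of
   [U]. This bounds [S v] below, and keeps the minimum from dropping under [h'] on [U]. *)
have S_le x v k : S v k -> forall ds, walk R v ds -> v + \sum_(d <- ds) d = x ->
    U x -> h' x <= k + (size ds)%:Z.
  move=> [y [es [Uy yes <- ->]]] ds vds <- Ux.
  have := walk_height _ _ _ UR bU h'alpha y (es ++ ds).
  rewrite big_cat addrA walk_cat yes vds size_cat => /(_ Uy Ux isT).
  by rewrite PoszD lerBlDl addrA.
have S_cat x y k : S x k -> forall ds, walk R x ds -> x + \sum_(d <- ds) d = y ->
    S y (k + (size ds)%:Z).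
  move=> [z [es [Uz zes <- ->]]] ds xds <-; exists z, (es ++ ds).
  by split; rewrite // ?walk_cat ?zes // ?big_cat ?addrA // size_cat PoszD addrA.
have b0R := UR _ (bU _ b0).
have S_refl x : U x -> S x (h' x).
  by exists x, [::]; rewrite big_nil !addr0.
(* Outside [R] the value is arbitrary. *)
have /choice[f fP] v : exists m, vertices R v ->
    S v m /\ forall k, S v k -> m <= k.
  have [vR|nvR] := pselect (vertices R v); last by exists 0.
  have [p vp p0] := conn _ _ vR b0R; have [ds vds dsE] := walk_connected _ _ _ vp.
  have [q zq qv] := conn _ _ b0R vR; have [es zes esE] := walk_connected _ _ _ zq.
  have [||m Sm minm] := int_set_min (S v) (h' (0, 0) - (size ds)%:Z).
  - exists (h' (0, 0) + (size es)%:Z).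
    by apply: (S_cat (0, 0)); rewrite ?esE //; apply/S_refl/bU.
  - move=> k Sk; rewrite lerBlDr; apply: S_le Sk _ vds _ (bU _ b0).
    by rewrite dsE.
  - by exists m.
have fU x : U x -> f x = h' x.
  move=> Ux; have [Sx minx] := fP _ (UR _ Ux).
  apply/eqP; rewrite eq_le (minx _ (S_refl _ Ux)) /=.
  by have := S_le x _ _ Sx [::] isT; rewrite big_nil !addr0; apply.
have fb x : boundary R x -> f x = h x.
  by move=> bx; rewrite fU ?h'b //; apply: bU.
exists f; split=> //; apply/heightsP; split; first by rewrite fb.
have f_mod v : vertices R v -> (f v = h v %[mod 3])%Z.
  move=> /fP[[x [ds [Ux xds <- ->]]] _].
  have := good_walk_mod _ _ goodh _ _ xds; have := h'mod _ Ux.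
  by move: (h' _) (h _) (h _) => a b c; lia.
move=> t x y tR xyt; have xy : white_left_in R x y by apply/white_left_inP; exists t.
have [xR yR] := white_left_in_vertices _ _ _ xy.
(* A walk to [x] is extended by the edge, and a walk to [y] by the two other sides of a triangle. *)
have le1 : f y <= f x + 1.
  apply: (fP _ yR).2; apply: (S_cat x _ _ (fP _ xR).1 [:: y - x]).
    by rewrite /= addrC subrK xy.
  by rewrite big_seq1 addrC subrK.
have le2 : f x <= f y + 2.
  have [ds [yds ds2 dsE]] := white_left_in_back _ _ _ xy.
  by apply: (fP _ xR).2; have := S_cat _ _ _ (fP _ yR).1 _ yds dsE; rewrite ds2.
(* The increment lies between -2 and 1 and is 1 modulo 3, as it is for [h]. *)
have [fxy|fxy] : f y - f x = 1 \/ f y - f x = -2.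
- have := f_mod _ xR; have := f_mod _ yR; have := good_edge _ _ goodh _ _ xy.
  move: (f x) (f y) (h x) (h y) le1 le2 => a b c d; clear; lia.
- by left.
(* If [u] were outside [R], both ends would be on the boundary, where [f] agrees with [h], whose
   increment on such an edge is 1. *)
right; split=> // u xyu; apply: contrapT => uR.
have /and3P[_ xu yu] := edges_is_edge _ _ _ xyu.
have [hxy|[_ /(_ _ xyu)//]] := goodh _ _ _ tR xyt.
move: fxy; rewrite !fb ?hxy //; split=> //; exists u => //; exact/negP.
Qed.
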